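(* Let $G$ be a finite group and $N$ a normal subgroup of $G$ with $G/N$ abelian. Write $\operatorname{rdim}(G)=n$. Then $$\operatorname{rdim}(G/N)\leq \frac{3n}{2}.$$
   Context: For a finite group $G$, $\operatorname{rdim}(G)$ is the smallest integer $n$ such that $G$ embeds into $\operatorname{GL}(n,\mathbb{C})$. *)

(* Defs.v *)
From HB Require Import structures.
From mathcomp Require Import all_boot all_order all_algebra all_fingroup all_solvable all_character.
From mathcomp Require Import boolp reals complex.

Set Implicit Arguments.
Unset Strict Implicit.
Unset Printing Implicit Defensive.

Import Order.TTheory GRing.Theory Num.Theory.
Local Open Scope ring_scope.

(* A homomorphism from G to GL(n, F) is an n-dimensional matrix representation;
   it is an embedding when mx_faithful. The value n = 0 is allowed, 'M[F]_0
   having a single (invertible) element; only the trivial group embeds then. *)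
Definition embeds_in_GL (F : fieldType) (gT : finGroupType) (G : {group gT})
    (n : nat) : Prop :=
  exists rG : mx_representation F G n, mx_faithful rG.

Lemma embeds_in_GL_ex (F : fieldType) (gT : finGroupType) (G : {group gT}) :
  exists n, `[< embeds_in_GL F G n >].
Proof.
by exists #|G|; apply/asboolP; exists (regular_repr F G); exact: regular_mx_faithful.
Qed.

Definition rdim (F : fieldType) (gT : finGroupType) (G : {group gT}) : nat :=
  ex_minn (embeds_in_GL_ex F G).

(* Main.v *)
(** [G / N] is abelian, so its representation dimension is at most its rank,
    which is the [p]-rank of [P / N] for a prime [p] and a Sylow [p]-subgroup
    [P] of [G].  Let [A] be a maximal normal abelian subgroup of [P]; then
    ['C_P(A) = A].  The given embedding diagonalises [A], providing [n] linear
    characters which separate the points of [A] and are permuted by [P], the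
    kernel of this action being [A].  The first fact gives ['r_p(A) <= n].  The
    second leaves a bound on permutation groups: an abelian quotient of a
    [p]-group of permutations of [s] points has order at most [p ^ (s / 2)].
    Altogether the rank of [P / N] is at most [n + n / 2].

    For the permutation bound induct on [s], for an abelian quotient [Q / N]
    with [Q] transitive and faithful.  Let [z] be central of order [p] in [Q];
    it moves every point.  Let [K] be the kernel of [Q] on the [s / p] orbits of
    [z].  If [K = Q] then [s = p] and [Q] has order [p].  Otherwise let [y] be
    central modulo [K]; it moves every orbit of [z].  As [K :&: N] contains the
    commutators of [y] with [K], its index in [K] is at most the order of
    ['C_K(y)].  An element of ['C_K(y)] commutes with [z] and [y] and preserves
    each orbit of [z], so it is determined by its values, [p] choices for each,
    at representatives of the orbits of [<z, y>].  These have at least [2 * p]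
    points each, so the index is at most [p ^ (s / (2 * p))], and so is that of
    [N * K] in [Q] by induction. *)

Require Import Defs.
From HB Require Import structures.
From mathcomp Require Import all_boot all_order all_algebra all_fingroup all_solvable all_character.
From mathcomp Require Import boolp reals complex.
From mathcomp Require Import separable cyclotomic.

Set Implicit Arguments.
Unset Strict Implicit.
Unset Printing Implicit Defensive.

Import Order.TTheory GRing.Theory Num.Theory.
Local Open Scope ring_scope.

(** * Abelian quotients of permutation p-groups *)

Section PermutationGroups.

Local Open Scope nat_scope.
Local Open Scope group_scope.

(** By the second isomorphism theorem. It separates the action on an orbit or on blocks from what is
    left to its kernel [K]. *)
Lemma index_join_cap (gT : finGroupType) (Q N K : {group gT}) :
  N <| Q -> K \subset Q -> #|Q : N| = (#|Q : N <*> K| * #|K : K :&: N|)%N.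
Proof.
move=> /andP[sNQ nNQ] sKQ; have nNK := subset_trans sKQ nNQ.
rewrite -(@Lagrange_index _ Q (N <*> K) N) ?joing_subl ?join_subG ?sNQ //.
by rewrite indexgI /= norm_joinEr ?indexMg.
Qed.

(* ['N_K(C :* y)] is the preimage in [K] of the centraliser of [y] modulo [C]. *)
Lemma index_le_centraliser (gT : finGroupType) (K M C : {group gT}) y :
    C \subset M -> M \subset K -> K \subset 'N(C) -> y \in 'N(C) ->
    {in K, forall k, y ^ k * y^-1 \in M} ->
  #|K : M| <= #|'N_K(C :* y) : C|.
Proof.
move=> sCM sMK nCK nCy yKM.
have sCK := subset_trans sCM sMK.
have sCD: C \subset 'N_K(C :* y).
  rewrite subsetI sCK; apply/subsetP=> c Cc; rewrite inE.
  apply/subsetP=> _ /imsetP[_ /rcosetP[d Cd ->] ->].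
  rewrite mem_rcoset conjgE -!mulgA groupM ?groupV // groupM // -{1}[y]invgK.
  by rewrite -conjgE memJ_norm ?groupV.
(* A [K]-conjugate of [C :* y] is [C :* (m * y)] with [m = y ^ k * y^-1] in [M], so there are at
   most [#|M : C|] of them. *)
have leKD: #|K : 'N_K(C :* y)| <= #|M : C|.
  rewrite -astab1Js -card_orbit.
  apply: leq_trans (leq_imset_card (fun X => X :* y) _).
  apply: subset_leq_card; apply/subsetP=> _ /imsetP[k Kk ->].
  apply/imsetP; exists (C :* (y ^ k * y^-1)).
    by rewrite mem_rcosets mulSGid ?yKM.
  rewrite -rcosetM mulgKV /= conjsMg conjg_set1.
  by rewrite (normsP nCK).
have := leq_mul leKD (leqnn #|'N_K(C :* y) : C|).
rewrite Lagrange_index ?subsetIl //.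
by rewrite -(Lagrange_index sMK sCM) mulnC leq_pmul2l.
Qed.

Section Action.

Variables (aT : finGroupType) (rT : finType) (to : {action aT &-> rT}).
Implicit Types (Q D K N : {group aT}) (S R : {set rT}).

(** Fixing the points of [R] one at a time multiplies the index by at most one orbit length at each
    step. *)
Lemma index_astab_le D R :
  #|D : 'C_D(R | to)| <= \prod_(x in R) #|orbit to D x|.
Proof.
have [n] := ubnP #|R|; elim: n => // n IHn in R *; move=> /ltnSE-leRn.
have [->|[x Rx]] := set_0Vmem R.
  by rewrite big_set0 (setIidPl _) ?indexgg // astabC sub0set.
rewrite (big_setD1 x) //=; have [ltR] : #|R :\ x| < n.
  by rewrite [#|R|](cardsD1 x) Rx in leRn.
have defR : 'C_D(R | to) = 'C_D(R :\ x | to) :&: 'C[x | to].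
  by rewrite -{1}(setD1K Rx) setUC astabU setIA.
have := @Lagrange_index _ D 'C_D(R :\ x | to)%G
  ('C_D(R :\ x | to) :&: 'C[x | to])%G.
rewrite defR mulnC => <-; rewrite ?subsetIl //.
rewrite leq_mul ?IHn // -card_orbit.
by rewrite subset_leq_card // imsetS // subsetIl.
Qed.

(** Commutation modulo the pointwise stabiliser of [S], as actions are not assumed faithful. *)
Definition commute_on S g h := {in S, forall x, to (to x g) h = to (to x h) g}.

(** [z] lifts an element of order [p] in the centre of the nontrivial [p]-group
    [Q / 'C_Q(S | to)]. *)
Lemma exists_central_on (p : nat) Q S :
    p.-group Q -> [acts Q, on S | to] -> ~~ (Q \subset 'C(S | to)) ->
  exists z, [/\ z \in Q, z \notin 'C(S | to), z ^+ p \in 'C(S | to)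
              & {in Q, forall g, commute_on S z g}].
Proof.
move=> pQ actsQ ntQ; set C := 'C_Q(S | to).
have nCQ : C <| Q.
  rewrite /normal subsetIl normsI ?normG //.
  exact: subset_trans actsQ (astab_norm _ _).
have pQb : p.-group (Q / C) by apply: quotient_pgroup.
have ntQb : Q / C != 1.
  rewrite -subG1 quotient_sub1 ?normal_norm //.
  by apply: contra ntQ => /subset_trans->//; apply: subsetIr.
have ntZ : 'Z(Q / C) != 1 by rewrite (center_nil_eq1 (pgroup_nil pQb)).
have pZ : p.-group 'Z(Q / C) by apply: pgroupS pQb; apply: center_sub.
have [p_pr p_dv _] := pgroup_pdiv pZ ntZ.
have [zb Zzb ozb] := Cauchy p_pr p_dv.
have /setIP[Qzb cQzb] := Zzb.
have /morphimP[z nCz Qz zbE] := Qzb.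
have sub1 g : g \in Q -> coset C g = 1 -> g \in 'C(S | to).
  move=> Qg /coset_idr; rewrite (subsetP (normal_norm nCQ)) //.
  by move=> /(_ isT) /setIP[].
exists z; split=> //.
- apply/negP=> Cz; have: zb = 1 by rewrite zbE; apply: coset_id; rewrite inE Qz.
  by move=> zb1; rewrite zb1 order1 in ozb; rewrite -ozb in p_pr.
- apply: sub1; first exact: groupX.
  by rewrite morphX //= -[coset C z]zbE -ozb expg_order.
move=> g Qg x Sx.
have nCg := subsetP (normal_norm nCQ) g Qg.
have: [~ z, g] \in 'C(S | to).
  apply: sub1; first by rewrite groupR.
  rewrite morphR //=; apply/eqP/commgP; rewrite -[coset C z]zbE.
  by apply: (centP cQzb); apply: mem_quotient.
move=> /astab_act/(_ (_ : to (to x g) z \in S))=> <-; last first.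
  by rewrite !(actsP actsQ).
by rewrite -!actM mulgA -commgC.
Qed.

Lemma commute_on_X Q S z g n :
  [acts Q, on S | to] -> z \in Q -> commute_on S z g -> commute_on S (z ^+ n) g.
Proof.
move=> actsQ Qz czg x Sx; elim: n x Sx => [|n IHn] x Sx; first by rewrite !act1.
by rewrite expgS !actM IHn ?(actsP actsQ) // czg.
Qed.


(** [Q] permutes the fixed points of [z] in [S], so by transitivity a single one would force all of
    [S]. *)
Lemma central_fpf Q S z :
    [transitive Q, on S | to] -> z \in Q -> z \notin 'C(S | to) ->
    {in Q, forall g, commute_on S z g} ->
  {in S, forall x, to x z != x}.
Proof.
move=> trQ Qz ntz czQ x Sx; apply: contra ntz => /eqP zx.
apply/astabP=> y Sy; have [g Qg ->] := atransP2 trQ Sx Sy.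
by rewrite -czQ // zx.
Qed.

(* Here [<[z]>]-orbits are the blocks, [K] acts inside them and [y] moves each
   of them; [r] is the number of orbits of [<<z, y>>]. *)
Lemma block_kernel_index (p : nat) Q K N S y z :
    [acts Q, on S | to] -> Q^`(1) \subset N ->
    'C_Q(S | to) \subset K :&: N -> K <| Q -> y \in Q -> z \in Q ->
    {in Q, forall g, commute_on S z g} ->
    {in S, forall x, #|orbit to <[z]> x| = p} ->
    {in K & S, forall k x, to x k \in orbit to <[z]> x} ->
    {in S, forall x, to x y \notin orbit to <[z]> x} ->
  exists2 r, #|K : K :&: N| <= p ^ r & 2 * p * r <= #|S|.
Proof.
move=> actsQ sQ'N sCM nsKQ Qy Qz czQ ozS oK oy.
have [sKQ nKQ] := andP nsKQ.
have nCQ : Q \subset 'N('C_Q(S | to)).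
  by rewrite normsI ?normG //; apply: subset_trans actsQ (astab_norm _ _).
pose D := 'N_K('C_Q(S | to) :* y)%G.
have czyD : {in D & S, forall k x, to (to x k) y = to (to x y) k}.
  move=> k x /setIP[Kk nk] Sx.
  have: y ^ k \in 'C_Q(S | to) :* y.
    by rewrite -(normP nk) memJ_conjg rcoset_refl.
  case/rcosetP=> c /setIP[Qc Cc] def_yk.
  rewrite -[RHS]actM conjgC def_yk !actM (astab_act Cc) //.
  by rewrite (actsP actsQ) // (subsetP sKQ).
pose H := (<[z]> <*> <[y]>)%G.
have sHQ : H \subset Q by rewrite join_subG !cycle_subG Qz.
have actsH : [acts H, on S | to] := subset_trans sHQ actsQ.
have [trR sRS _ transv] := orbit_transversalP actsH.
set R := orbit_transversal to H S in trR sRS.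
have oR : #|R| = #|orbit to H @: S| by rewrite (card_transversal trR).
exists #|R|.
  have sDK : D \subset K by apply: subsetIl.
  (* The fixed points in [S] of [k] in [D] form an [H]-stable set, as [k] commutes with [z] and [y]
     on [S]. Once it contains [R], which meets every [H]-orbit, it is [S]. *)
  have sCRC : 'C_D(R | to) \subset 'C_Q(S | to).
    apply/subsetP=> k /setIP[Dk CRk].
    have Qk := subsetP (subset_trans sDK sKQ) k Dk.
    rewrite inE Qk; apply/astabP=> x Sx.
    have actsF : [acts H, on S :&: 'Fix_to[k] | to].
      rewrite join_subG !cycle_subG; apply/andP; split; rewrite !inE;
        apply/subsetP=> w; rewrite !inE !sub1set !inE => /andP[Sw /eqP fw].
        by rewrite (actsP actsQ) // Sw (czQ k Qk w Sw) fw /=.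
      by rewrite (actsP actsQ) // Sw -(czyD k w Dk Sw) fw /=.
    have [h Hh Rxh] := transv x Sx.
    have: to x h \in S :&: 'Fix_to[k].
      by rewrite inE (subsetP sRS) //; apply/afix1P; apply: astab_act CRk _.
    by rewrite (actsP actsF) // => /setIP[_ /afix1P].
  have leKD : #|K : K :&: N| <= #|D : 'C_Q(S | to)|.
    apply: index_le_centraliser; rewrite ?subsetIl //.
    - exact: subset_trans nCQ.
    - exact: (subsetP nCQ).
    move=> k Kk; have Qk := subsetP sKQ k Kk.
    have -> : y ^ k * y^-1 = [~ k, y^-1].
      by rewrite commgEl !conjgE invgK !mulgA.
    have nKy : y^-1 \in 'N(K) by rewrite groupV (subsetP nKQ).
    rewrite inE commgEl groupM ?groupV ?memJ_norm //=.
    by rewrite -commgEl (subsetP sQ'N) // mem_commg ?groupV.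
  apply: leq_trans leKD _.
  apply: leq_trans (dvdn_leq (indexg_gt0 _ _) (indexgS _ sCRC)) _.
  apply: (leq_trans (index_astab_le D R)).
  rewrite -prod_nat_const; apply: leq_prod => x Rx; have Sx := subsetP sRS x Rx.
  rewrite -(ozS x Sx) subset_leq_card //; apply/subsetP=> _ /imsetP[k Dk ->].
  by rewrite oK // (subsetP sDK).
(* The [H]-orbit of [x] contains the [<[z]>]-orbits of [x] and of [to x y], which are disjoint with
   [p] points each. *)
rewrite -(acts_sum_card_orbit actsH) oR mulnC.
rewrite -sum_nat_const leq_sum //= => _ /imsetP[x Sx ->].
have Syx : to x y \in S by rewrite (actsP actsQ).
rewrite mul2n -addnn -{1}(ozS _ Sx) -(ozS _ Syx).
have [_ /esym dis] :=
  leq_card_setU (orbit to <[z]> x) (orbit to <[z]> (to x y)).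
rewrite -(eqP (etrans (esym dis) _)); last first.
  apply/pred0P=> w /=; apply/negP=> /andP[/orbit_eqP e1 /orbit_eqP e2].
  by case/negP: (oy x Sx); rewrite -e1 e2 orbit_refl.
have Hy : y \in H by rewrite mem_gen // inE cycle_id orbT.
have sZH : <[z]> \subset H by apply: joing_subl.
rewrite subset_leq_card // subUset -{2}(orbit_act to x Hy).
by rewrite !imsetS.
Qed.

Lemma setact_orbit_cycle Q S z g x :
    [acts Q, on S | to] -> z \in Q -> commute_on S z g -> x \in S ->
  to^*%FUN (orbit to <[z]> x) g = orbit to <[z]> (to x g).
Proof.
move=> actsQ Qz czg Sx; rewrite setactE -imset_comp.
apply: eq_in_imset => _ /cycleP[i ->] /=.
by rewrite (commute_on_X i actsQ Qz czg).
Qed.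

Lemma card_orbit_cycle_prime p z x :
  prime p -> to x (z ^+ p) = x -> to x z != x -> #|orbit to <[z]> x| = p.
Proof.
move=> p_pr fixzp movz.
have: #|orbit to <[z]> x| %| p.
  rewrite card_orbit; apply: (@dvdn_trans #|<[z]> : <[z ^+ p]>|).
    apply: indexgS; rewrite subsetI cycleX cycle_subG.
    by apply/astab1P.
  rewrite -divgS ?cycleX // -![#|<[_]>|]/(#[_]) orderXgcd.
  by rewrite divnA ?dvdn_gcdl // mulKn ?order_gt0 ?dvdn_gcdr.
case/primeP: p_pr => _ dvp /dvp/orP[/eqP/card_orbit1 oz | /eqP//].
by case/eqP: movz; apply/set1P; rewrite -oz mem_orbit ?cycle_id.
Qed.

End Action.

(** Squaring avoids rounding [s / 2]. The induction passes to blocks, hence to another type and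
    action, and to orbits; faithfulness would be lost there, so it is weakened to
    ['C_Q(S | to) \subset N]. *)
Lemma perm_pgroup_index (p s : nat) (aT : finGroupType) (rT : finType)
    (to : {action aT &-> rT}) (Q N : {group aT}) (S : {set rT}) :
    prime p -> #|S| = s -> p.-group Q -> [acts Q, on S | to] ->
    Q^`(1) \subset N -> N \subset Q -> 'C_Q(S | to) \subset N ->
  #|Q : N| ^ 2 <= p ^ s.
Proof.
move=> p_pr; elim/ltn_ind: s => s IHs in rT to Q N S *.
move=> cardS pQ actsQ sQ'N sNQ sCN; have p_gt0 := prime_gt0 p_pr.
have nsNQ := sub_der1_normal sQ'N sNQ.
have [sQC | ntQ] := boolP (Q \subset 'C(S | to)).
  have -> : N :=: Q by apply/eqP; rewrite eqEsubset sNQ -{1}(setIidPl sQC).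
  by rewrite indexgg exp1n expn_gt0 p_gt0.
have [S0 | [x Sx]] := set_0Vmem S; first by rewrite S0 astabC sub0set in ntQ.
have [defS | neS] := eqVneq (orbit to Q x) S; last first.
  (* Intransitive case: [Q] acts on the orbit [O], and the kernel [C] of this action acts on the
     rest of [S]; the two bounds multiply. *)
  set O := orbit to Q x in neS; pose C := 'C_Q(O | to)%G.
  have sOS : O \subset S by rewrite acts_sub_orbit.
  have sCQ : C \subset Q by apply: subsetIl.
  have ltO : #|O| < s by rewrite -cardS proper_card // properEneq neS.
  have oSO : (#|O| + #|S :\: O| = s)%N.
    by rewrite -cardS -(cardsID O S) (setIidPr sOS).
  have ltSO : #|S :\: O| < s.
    rewrite -oSO -[X in X < _]add0n ltn_add2r card_gt0.
    by apply/set0Pn; exists x; apply: orbit_refl.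
  rewrite (index_join_cap nsNQ sCQ) expnMn -oSO expnD leq_mul //.
    apply: (IHs _ ltO _ to Q (N <*> C)%G O) => //.
    - by apply: acts_orbit; apply: subsetT.
    - exact: subset_trans sQ'N (joing_subl _ _).
    - by rewrite join_subG sNQ.
    exact: joing_subr.
  apply: (IHs _ ltSO _ to C (C :&: N)%G (S :\: O)) => //.
  - exact: pgroupS pQ.
  - apply: subset_trans (astabsD _ _ _); rewrite subsetI (subset_trans sCQ) //=.
    by apply: subset_trans sCQ _; apply: acts_orbit; apply: subsetT.
  - by rewrite subsetI der_sub (subset_trans (dergS _ sCQ)).
  - exact: subsetIl.
  rewrite subsetI subsetIl (subset_trans _ sCN) //= -setIA -astabU.
  by rewrite -{1}(setIidPr sOS) setID.
have trQ : [transitive Q, on S | to] by rewrite -defS atrans_orbit.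
have [z [Qz ntz zp1 czQ]] := exists_central_on pQ actsQ ntQ.
have fpz := central_fpf trQ Qz ntz czQ.
have ozS : {in S, forall x, #|orbit to <[z]> x| = p}.
  move=> w Sw; apply: card_orbit_cycle_prime (fpz w Sw) => //.
  exact: astab_act zp1 Sw.
have actsz : [acts <[z]>, on S | to].
  by rewrite (subset_trans _ actsQ) ?cycle_subG.
pose S' := orbit to <[z]> @: S.
have oS' : #|S| = (#|S'| * p)%N.
  apply: card_uniform_partition (orbit_partition actsz).
  by move=> _ /imsetP[w Sw ->]; apply: ozS.
have actQ g w : g \in Q -> w \in S ->
  to^*%FUN (orbit to <[z]> w) g = orbit to <[z]> (to w g).
  by move=> Qg Sw; apply: (setact_orbit_cycle actsQ) => //; apply: czQ.
have trQ' : [transitive Q, on S' | to^*%act].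
  have -> : S' = orbit to^*%act Q (orbit to <[z]> x).
    rewrite /S' -defS -imset_comp; apply: eq_in_imset => g Qg /=.
    by rewrite actQ.
  by rewrite atrans_orbit.
have actsQ' := atrans_acts trQ'.
pose K := 'C_Q(S' | to^*%act)%G.
have sKQ : K \subset Q by apply: subsetIl.
have nsKQ : K <| Q.
  rewrite /normal sKQ normsI ?normG //.
  exact: subset_trans actsQ' (astab_norm _ _).
have oK : {in K & S, forall k w, to w k \in orbit to <[z]> w}.
  move=> k w /setIP[_ Ck] Sw.
  have <- : to^*%FUN (orbit to <[z]> w) k = orbit to <[z]> w.
    by apply: (astab_act Ck); apply: imset_f.
  by rewrite mem_setact ?orbit_refl.
have [sQC' | ntQ'] := boolP (Q \subset 'C(S' | to^*%act)).
  (* [Q] fixes every block, so by transitivity there is only one. A point stabiliser commutes with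
     [z], hence is trivial on [S], and the index is at most [p]. *)
  have sSz : S \subset orbit to <[z]> x.
    rewrite -defS; apply/subsetP=> _ /imsetP[k Qk ->].
    by apply: oK => //; rewrite inE Qk (subsetP sQC').
  have es : s = p.
    rewrite -cardS -(ozS x Sx); apply/eqP.
    by rewrite eqn_leq !subset_leq_card // acts_sub_orbit.
  have sCxN : 'C_Q[x | to] \subset N.
    apply: subset_trans sCN; apply/subsetP=> k /setIP[Qk /astab1P fk].
    rewrite inE Qk; apply/astabP=> w /(subsetP sSz)/imsetP[_ /cycleP[i ->] ->].
    by rewrite (commute_on_X i actsQ Qz (czQ k Qk)) // fk.
  apply: (@leq_trans (p ^ 2)); last by rewrite leq_pexp2l // es prime_gt1.
  rewrite leq_exp2r // -es -cardS -defS card_orbit dvdn_leq ?indexg_gt0 //.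
  exact: indexgS.
have [y [Qy nty _ cyQ]] := exists_central_on pQ actsQ' ntQ'.
have fpy := central_fpf trQ' Qy nty cyQ.
have [||r ler lers] :=
  @block_kernel_index _ _ to p Q K N S y z actsQ sQ'N _ nsKQ Qy Qz czQ ozS oK.
- rewrite subsetI sCN andbT subsetI subsetIl /=.
  apply/subsetP=> c /setIP[Qc Cc]; apply/astabP=> _ /imsetP[w Sw ->].
  by rewrite /= actQ // (astab_act Cc).
- move=> w Sw; apply: contra (fpy _ (imset_f _ Sw)) => /orbit_eqP e.
  by rewrite /= actQ // e.
have ltS' : #|S'| < s.
  rewrite -cardS oS' ltn_Pmulr ?prime_gt1 // card_gt0.
  by apply/set0Pn; exists (orbit to <[z]> x); apply: imset_f.
rewrite (index_join_cap nsNQ sKQ) expnMn.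
apply: (@leq_trans (p ^ #|S'| * (p ^ r) ^ 2)%N); last first.
  have p_gt1 := prime_gt1 p_pr.
  rewrite -expnM -expnD leq_pexp2l // -cardS oS'.
  (* The exponent needed is [#|S'| + 2 * r], at most [2 * #|S'|] and so at most [#|S'| * p = s]. *)
  have: r * 2 <= #|S'|.
    by rewrite -(leq_pmul2r p_gt0) -oS' mulnAC mulnC [(r * p)%N]mulnC mulnA.
  rewrite -(leq_add2l #|S'|) => /leq_trans-> //.
  by rewrite addnn -muln2 leq_mul2l p_gt1 orbT.
apply: leq_mul; last by rewrite leq_exp2r.
apply: (IHs _ ltS' _ to^*%act Q (N <*> K)%G S') => //.
- exact: subset_trans sQ'N (joing_subl _ _).
- by rewrite join_subG sNQ.
exact: joing_subr.
Qed.

End PermutationGroups.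

(** * Separating families of linear characters *)

Section Characters.

Variable F : numClosedFieldType.

Lemma Xn_sub_1_factors (m : nat) : (m > 0)%N ->
  exists2 r : seq F, uniq r & 'X^m - 1 = \prod_(z <- r) ('X - z%:P).
Proof.
move=> m_gt0; have [r Dp] := closed_field_poly_normal ('X^m - 1 : {poly F}).
rewrite (monicP _) ?monicXnsubC // scale1r in Dp; exists r => //.
by rewrite -separable_prod_XsubC -Dp separable_Xn_sub_1 // pnatr_eq0 -lt0n.
Qed.

Lemma prim_root_exists m : (m > 0)%N -> exists z : F, m.-primitive_root z.
Proof.
move=> m_gt0; have [r Ur Dp] := Xn_sub_1_factors m_gt0.
have rn1: all m.-unity_root r by apply/allP=> z; rewrite -root_prod_XsubC -Dp.
have sz_r: (m < (size r).+1)%N.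
  by rewrite -(size_prod_XsubC r id) -Dp size_XnsubC.
by have [z _ prim_z] := hasP (has_prim_root m_gt0 rn1 Ur sz_r); exists z.
Qed.

(** The minimal polynomial divides ['X^m - 1], which splits with distinct roots. *)
Lemma finite_order_diagonalizable n m (M : 'M[F]_n.+1) :
  (m > 0)%N -> M ^+ m = 1 -> diagonalizable M.
Proof.
move=> m_gt0 Mm1; have [r Ur Dp] := Xn_sub_1_factors m_gt0.
apply/diagonalizableP; exists r => //; rewrite -Dp mxminpoly_min //.
by rewrite rmorphB rmorphXn /= horner_mx_X rmorph1 Mm1 subrr.
Qed.

(** Amounts to an embedding of [A] in the diagonal matrices of size [n]; values outside [A] are
    arbitrary. *)
Definition separating_chars (gT : finGroupType) (A : {group gT}) n
    (chi : 'I_n -> gT -> F) :=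
  [/\ forall i, chi i 1%g = 1,
      forall i, {in A &, {morph chi i : a b / (a * b)%g >-> a * b}}
    & {in A, forall a, (forall i, chi i a = 1) -> a = 1%g}].

Lemma char_prim_root (gT : finGroupType) (A : {group gT}) n m
    (chi : 'I_n -> gT -> F) (w : F) i a :
    separating_chars A chi -> m.-primitive_root w ->
    a \in A -> (a ^+ m = 1)%g ->
  {k : 'I_m | chi i a = w ^+ k}.
Proof.
case=> chi1 chiM _ prim_w Aa am1; apply: (prim_rootP prim_w).
have chiX k : chi i (a ^+ k)%g = chi i a ^+ k.
  elim: k => [|k IHk]; first by rewrite expr0 expg0.
  by rewrite expgS chiM ?groupX // IHk exprS.
by rewrite -chiX am1.
Qed.

Lemma repr_diagonal (gT : finGroupType) (G A : {group gT}) n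
    (rG : mx_representation F G n) :
    A \subset G -> abelian A ->
  exists2 B : 'M[F]_n, B \in unitmx
    & {in A, forall a, is_diag_mx (B *m rG a *m invmx B)}.
Proof.
case: n rG => [|n] rG sAG cAA.
  exists 1%:M; first exact: unitmx1.
  by move=> a _; apply/is_diag_mxP=> -[].
have [|B uB /allP dB] := (codiagonalizableP [seq rG a | a in A]).1.
  split.
    move=> _ _ /imageP[a Aa ->] /imageP[b Ab ->].
    have [Ga Gb] := (subsetP sAG a Aa, subsetP sAG b Ab).
    by rewrite /comm_mx -!repr_mxM // (centsP cAA).
  move=> _ /imageP[a Aa ->]; have Ga := subsetP sAG a Aa.
  apply: (@finite_order_diagonalizable _ #[a]%g); first exact: order_gt0.
  by rewrite -repr_mxX // expg_order repr_mx1.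
exists B => // a Aa; rewrite -conjumx //.
by apply: (dB (rG a)); apply: image_f.
Qed.

(** The characters are the diagonal entries in a basis diagonalising [A]; the normaliser of [A]
    permutes the joint eigenspaces. *)
Lemma abelian_separating_chars (gT : finGroupType) (G A : {group gT}) n
    (rG : mx_representation F G n) :
    mx_faithful rG -> A \subset G -> abelian A ->
  exists2 chi : 'I_n -> gT -> F, separating_chars A chi
    & {in 'N_G(A)%g, forall g i, exists j,
          {in A, forall a, chi j a = chi i (a ^ g)%g}}.
Proof.
move=> ffulG sAG cAA; have [B uB dB] := repr_diagonal rG sAG cAA.
pose M g := B *m rG g *m invmx B.
have MM : {in G &, {morph M : g h / (g * h)%g >-> g *m h}}.
  by move=> g h Gg Gh; rewrite /M repr_mxM // !mulmxA mulmxKV.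
have M1 : M 1%g = 1%:M by rewrite /M repr_mx1 mulmx1 mulmxV.
have dM a i j : a \in A -> M a i j = M a i i *+ (i == j).
  by move=> Aa; rewrite /M; have /diag_mxP[d ->] := dB a Aa; rewrite !mxE eqxx.
exists (fun i g => M g i i); first split.
- by move=> i; rewrite M1 mxE eqxx.
- move=> i a b Aa Ab; rewrite MM ?(subsetP sAG) // mxE (bigD1 i) //=.
  rewrite big1 ?addr0 // => j ne_ji.
  by rewrite [M a i j]dM // eq_sym (negPf ne_ji) mul0r.
- move=> a Aa chi1; have Ga := subsetP sAG a Aa.
  apply: (mx_faithful_inj ffulG) => //.
  have : M a = M 1%g by apply/matrixP=> i j; rewrite M1 dM // chi1 mxE.
  move/(congr1 (fun C => invmx B *m C *m B)).
  by rewrite /M -!mulmxA !mulKmx // !mulmxA !mulmxKV.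
move=> g /setIP[Gg nAg] i; pose C := M g^-1%g.
(* An invertible matrix has no zero row. At a nonzero entry [C i j], comparing the two sides of
   [C *m M a = M (a ^ g) *m C] identifies the characters [j] and [i] conjugated by [g]. *)
have [j nz_j] : exists j, C i j != 0.
  apply/existsP; apply: contraT; rewrite negb_exists => /forallP z_i.
  have /matrixP/(_ i i) : C *m M g = 1%:M by rewrite -MM ?groupV // mulVg.
  rewrite !mxE eqxx big1 => [/esym/eqP|j _]; first by rewrite oner_eq0.
  by rewrite (eqP (negPn (z_i j))) mul0r.
exists j => a Aa; have Ga := subsetP sAG a Aa.
have Aag : (a ^ g)%g \in A by rewrite memJ_norm.
have eqC : C *m M a = M (a ^ g)%g *m C.
  by rewrite -!MM ?groupV // ?(subsetP sAG (a ^ g)%g) // conjgE !mulgA mulgK.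
have LE : (C *m M a) i j = C i j * M a j j.
  rewrite mxE (bigD1 j) //= big1 ?addr0 // => k ne_kj.
  by rewrite [M a k j]dM // (negPf ne_kj) mulr0.
have RE : (M (a ^ g)%g *m C) i j = M (a ^ g)%g i i * C i j.
  rewrite mxE (bigD1 i) //= big1 ?addr0 // => k ne_ki.
  by rewrite [M _ i k]dM // eq_sym (negPf ne_ki) mul0r.
by apply: (mulIf nz_j); rewrite -RE -eqC LE mulrC.
Qed.

(** All values are [m]-th roots of unity, so an element is determined by [n] exponents modulo
    [m]. *)
Lemma card_separating_chars (gT : finGroupType) (E : {group gT}) n m
    (chi : 'I_n -> gT -> F) :
    separating_chars E chi -> (m > 0)%N -> {in E, forall a, a ^+ m = 1}%g ->
  (#|E| <= m ^ n)%N.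
Proof.
case: m => // m sep_chi _ Em; have [chi1 chiM sep] := sep_chi.
have [w prim_w] := prim_root_exists (ltn0Sn m).
have chiV i a (Ea : a \in E) := char_prim_root i sep_chi prim_w Ea (Em a Ea).
(* The default [ord0] is never reached for [a] in [E]. *)
pose f a := [ffun i => odflt ord0 [pick k : 'I_m.+1 | chi i a == w ^+ k]].
have fE a i : a \in E -> chi i a = w ^+ f a i.
  move=> Ea; rewrite ffunE; case: pickP => [k /eqP-> // | no_k].
  by have [k /eqP] := chiV i a Ea; rewrite no_k.
have inj_f : {in E &, injective f}.
  move=> a b Ea Eb eq_f; apply/eqP; rewrite eq_mulgV1; apply/eqP.
  apply: sep => [|i]; first by rewrite groupM ?groupV.
  have nz_b : chi i b != 0.
    apply/eqP=> b0; have := chi1 i; rewrite -(mulgV b) chiM ?groupV // b0 mul0r.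
    by move/esym/eqP; rewrite oner_eq0.
  apply: (mulIf nz_b); rewrite mul1r -chiM ?groupM ?groupV // mulgKV.
  by rewrite !fE // eq_f.
rewrite -(card_in_imset inj_f); apply: leq_trans (max_card _) _.
by rewrite card_ffun !card_ord.
Qed.

Lemma p_rank_separating_chars (gT : finGroupType) (A : {group gT}) n p
    (chi : 'I_n -> gT -> F) :
  prime p -> separating_chars A chi -> ('r_p(A)%g <= n)%N.
Proof.
move=> p_pr [chi1 chiM sep].
have [E /pnElemP[sEA abelE <-]] := p_rank_witness p A.
have p_gt1 := prime_gt1 p_pr.
rewrite -(leq_exp2l _ _ p_gt1) -(card_pgroup (abelem_pgroup abelE)).
apply: (@card_separating_chars _ E n p chi) => [|| a Ea].
- split=> // [i a b Ea Eb | a Ea]; first by rewrite chiM ?(subsetP sEA).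
  by apply: sep; apply: (subsetP sEA).
- exact: prime_gt0.
by have [_ _ /exponentP->] := and3P abelE.
Qed.

Lemma cyclic_separating_char (gT : finGroupType) (x : gT) :
  exists2 psi : gT -> F, psi 1%g = 1
    /\ {in <[x]>%g &, {morph psi : a b / (a * b)%g >-> a * b}}
    & {in <[x]>%g, forall a, psi a = 1 -> a = 1%g}.
Proof.
have [w prim_w] := prim_root_exists (order_gt0 x).
pose psi a :=
  if [pick k : 'I_(#[x]%g) | a == (x ^+ k)%g] is Some k then w ^+ k else 0.
have psiE k : psi (x ^+ k)%g = w ^+ k.
  rewrite /psi; case: pickP => [j | no_k].
    rewrite eq_expg_mod_order => /eqP eq_kj; apply/eqP.
    by rewrite (eq_prim_root_expr prim_w) eq_kj.
  have ltk : (k %% #[x]%g < #[x]%g)%N by rewrite ltn_mod order_gt0.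
  by have /eqP[] := no_k (Ordinal ltk); rewrite /= expg_mod_order.
exists psi; first split.
- by rewrite -(expg0 x) psiE.
- move=> _ _ /cycleP[j ->] /cycleP[k ->].
  by rewrite -expgD !psiE exprD.
move=> _ /cycleP[k ->]; rewrite psiE => /eqP.
rewrite -(prim_order_dvd prim_w) => /dvdnP[j ->].
by rewrite mulnC expgM expg_order expg1n.
Qed.

(** [E] is a direct product of ['r(E)] cyclic groups; each factor gives one faithful character,
    extended trivially to the others. *)
Lemma rank_separating_chars (gT : finGroupType) (E : {group gT}) :
  abelian E -> exists chi : 'I_('r(E)%g) -> gT -> F, separating_chars E chi.
Proof.
move=> cEE; have [b defE defb] := abelian_structure cEE.
rewrite -(size_abelian_type cEE) -defb size_map {defb cEE}.
elim: b => [|x b IHb] in E defE *.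
  exists (fun _ _ => 1); split=> // [i a c _ _ | a]; first by rewrite mulr1.
  by rewrite -defE big_nil => /set1P.
rewrite big_cons in defE; have [[_ H _ defH] _ _ tiXH] := dprodP defE.
have [phi [phi1 phiM phiS]] := IHb H defH; rewrite defH in defE tiXH.
have [psi [psi1 psiM] psiS] := cyclic_separating_char x.
have [nsXE sHE mulXH _ _] := sdprod_context (dprodWsd defE).
have [nsHE sXE mulHX _ _] := sdprod_context (dprodWsdC defE).
have [cX cH] := (sdprod_compl (dprodWsd defE), sdprod_compl (dprodWsdC defE)).
have [remM rem'M] := (remgrM cX nsXE, remgrM cH nsHE).
have memH a : a \in E -> remgr <[x]>%g H a \in H.
  by rewrite -mulXH; apply: mem_remgr.
have memX a : a \in E -> remgr H <[x]>%g a \in <[x]>%g.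
  by rewrite -mulHX; apply: mem_remgr.
(* The two [remgr] terms are the components of [a] in [H] and in [<[x]>]; index [0] goes to the new
   factor. *)
pose chi i a :=
  if unlift ord0 i is Some j then phi j (remgr <[x]>%g H a)
  else psi (remgr H <[x]>%g a).
exists (chi : 'I_(size b).+1 -> gT -> F); split=> [i|i a c Ea Ec|a Ea chi1].
- by rewrite /chi !remgr1 //; case: unlift.
- rewrite /chi remM // rem'M //.
  by case: unlift => [j|]; [apply: phiM | apply: psiM]; auto.
have remH : remgr <[x]>%g H a = 1%g.
  apply: phiS => [|j]; first exact: memH.
  by have := chi1 (lift ord0 j); rewrite /chi liftK.
have remX : remgr H <[x]>%g a = 1%g.
  by apply: psiS; [apply: memX | have := chi1 ord0; rewrite /chi unlift_none].
apply/set1gP; rewrite -tiXH inE; apply/andP; split.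
  by rewrite (divgr_eq <[x]>%g H a) remH mulg1 mem_divgr ?mulXH.
by rewrite (divgr_eq H <[x]>%g a) remX mulg1 mem_divgr ?mulHX.
Qed.

Lemma embeds_separating_chars (gT : finGroupType) (E : {group gT}) n
    (chi : 'I_n -> gT -> F) :
  separating_chars E chi -> exists rE : mx_representation F E n, mx_faithful rE.
Proof.
case=> chi1 chiM sep; pose r a := diag_mx (\row_i chi i a).
have r_repr : mx_repr E r.
  split; first by apply/matrixP=> i j; rewrite !mxE chi1.
  move=> a b Ea Eb; rewrite mulmx_diag; congr diag_mx.
  by apply/rowP=> i; rewrite !mxE chiM.
exists (MxRepresentation r_repr); apply/subsetP=> a.
rewrite !inE mul1mx => /andP[Ea /eqP/matrixP ra1]; apply/eqP; apply: sep => // i.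
by have := ra1 i i; rewrite !mxE eqxx.
Qed.

End Characters.

(** * Linear p-groups *)

Section LinearPGroups.

Local Open Scope nat_scope.
Local Open Scope group_scope.

(** The inverse makes this a right action. *)
Definition ffun_conj (gT : finGroupType) (T : finType) (f : {ffun gT -> T}) g :=
  [ffun a => f (a ^ g^-1)].

Lemma ffun_conj1 (gT : finGroupType) (T : finType) : @ffun_conj gT T ^~ 1 =1 id.
Proof. by move=> f; apply/ffunP=> a; rewrite ffunE invg1 conjg1. Qed.

Lemma ffun_conjM (gT : finGroupType) (T : finType) f :
  act_morph (@ffun_conj gT T) f.
Proof. by move=> g h; apply/ffunP=> a; rewrite !ffunE invMg conjgM. Qed.

Definition ffun_conj_action (gT : finGroupType) (T : finType) :=
  TotalAction (@ffun_conj1 gT T) (@ffun_conjM gT T).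

Variable F : numClosedFieldType.

(** [P] permutes the at most [n] distinct characters. An element fixing them all centralises [A],
    since they separate its points, so the permutation bound applies. *)
Lemma pgroup_chars_index (gT : finGroupType) (p n : nat) (P A N : {group gT})
    (chi : 'I_n -> gT -> F) :
    prime p -> p.-group P -> A <| P -> separating_chars A chi ->
    {in P, forall g i, exists j, {in A, forall a, chi j a = chi i (a ^ g)}} ->
    P^`(1) \subset N -> N \subset P -> 'C_P(A) \subset N ->
  #|P : N| ^ 2 <= p ^ n.
Proof.
move=> p_pr pP nsAP sep_chi chiJ sP'N sNP sCN.
have [chi1 chiM sep] := sep_chi.
have [sAP nAP] := andP nsAP.
have [w prim_w] := prim_root_exists F (cardG_gt0 A).
have chiV i a (Aa : a \in A) :=
  char_prim_root i sep_chi prim_w Aa (expg_cardG Aa).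
(* [P] has to act on a finite type, so [chi i] is encoded by the exponents of
   its values as powers of [w], with [None] outside [A]. *)
pose f i :=
  [ffun a => [pick k : 'I_#|A| | (a \in A) && (chi i a == (w ^+ k)%R)]].
have fE i j a b : a \in A -> b \in A -> (f i a == f j b) = (chi i a == chi j b).
  move=> Aa Ab; rewrite !ffunE Aa Ab /=.
  case: pickP => [k /eqP-> | no_k]; last first.
    by have [k /eqP] := chiV i a Aa; rewrite no_k.
  case: pickP => [l /eqP-> | no_l]; last first.
    by have [l /eqP] := chiV j b Ab; rewrite no_l.
  by rewrite (eq_prim_root_expr prim_w) !modn_small.
pose to := ffun_conj_action gT (option 'I_#|A|).
pose X := [set f i | i : 'I_n].
have leX : #|X| <= n by rewrite -[X in _ <= X]card_ord; apply: leq_imset_card.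
have actsP : [acts P, on X | to].
  apply/subsetP=> g Pg; rewrite !inE.
  apply/subsetP=> _ /imsetP[i _ ->]; rewrite inE.
  have [j chij] := chiJ _ (groupVr Pg) i; apply/imsetP; exists j => //.
  apply/ffunP=> a; rewrite !ffunE; apply: eq_pick => k /=.
  have nAg : g^-1 \in 'N(A) by rewrite groupV (subsetP nAP).
  by rewrite memJ_norm //; case Aa: (a \in A) => //=; rewrite chij.
apply: leq_trans (_ : p ^ #|X| <= p ^ n); last by rewrite leq_pexp2l ?prime_gt0.
apply: (perm_pgroup_index p_pr (erefl _) pP actsP) => //.
apply: subset_trans sCN; apply/subsetP=> g /setIP[Pg Cg]; rewrite inE Pg.
rewrite -groupV; apply/centP=> a Aa; apply: commute_sym.
apply/commgP/conjg_fixP.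
have nAg : g^-1 \in 'N(A) by rewrite groupV (subsetP nAP).
have Aag : a ^ g^-1 \in A by rewrite memJ_norm.
apply/eqP; rewrite eq_mulgV1; apply/eqP; apply: sep => [|i].
  by rewrite groupM ?groupV.
have Xfi : f i \in X by apply/imsetP; exists i.
have eq_chi : chi i (a ^ g^-1) = chi i a.
  by apply/eqP; rewrite -fE // -{2}(astab_act Cg Xfi) /= [X in _ == X]ffunE.
rewrite chiM ?groupV // eq_chi.
by rewrite -chiM ?groupV // mulgV chi1.
Qed.

(** An elementary abelian [E] of maximal rank in [P / N] is cut by [A / N]: the intersection has
    rank at most ['r_p(A)], and its index in [E] is at most [#|P : N <*> A|]. *)
Lemma pgroup_quotient_p_rank (gT : finGroupType) (p n : nat) (P N : {group gT})
    (rP : mx_representation F P n) :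
    prime p -> p.-group P -> mx_faithful rP -> N <| P -> abelian (P / N) ->
  2 * 'r_p(P / N) <= 3 * n.
Proof.
move=> p_pr pP ffulP nsNP abPN; have [sNP nNP] := andP nsNP.
have [A maxA _] :
    {A : {group gT} | [max A | A <| P & abelian A] & 1%G \subset A}.
  by apply: maxgroup_exists; rewrite normal1 abelian1.
have SCN_A := max_SCN pP maxA; have cAA := SCN_abelian SCN_A.
have [nsAP defCA] := SCN_P SCN_A; have [sAP nAP] := andP nsAP.
have [chi sep_chi chiJ] := abelian_separating_chars ffulP sAP cAA.
have rA := p_rank_separating_chars p_pr sep_chi.
have sJP : N <*> A \subset P by rewrite join_subG sNP.
have nNA := subset_trans sAP nNP.
have oPJ : #|P : N <*> A| ^ 2 <= p ^ n.
  apply: (@pgroup_chars_index _ p n P A (N <*> A)%G chi) => //.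
  - by move=> g Pg; apply: chiJ; rewrite inE Pg (subsetP nAP).
  - apply: subset_trans (joing_subl _ _).
    by rewrite der1_min.
  - by rewrite defCA joing_subr.
have [E EpE] := p_rank_witness p (P / N); have [sES abelE rE] := pnElemP EpE.
have oE : #|E| = (p ^ 'r_p(P / N))%N.
  by rewrite -rE -card_pgroup // abelem_pgroup.
have oEB : #|E :&: A / N| <= p ^ n.
  have sEBE : E :&: A / N \subset E by apply: subsetIl.
  rewrite (card_pgroup (pgroupS sEBE (abelem_pgroup abelE))).
  rewrite leq_pexp2l ?prime_gt0 //; apply: leq_trans rA.
  apply: leq_trans (quotient_p_rank_abelian _ _ cAA).
  by apply: logn_le_p_rank; rewrite inE subsetIr (abelemS sEBE).
have oEI : #|E : A / N| <= #|P : N <*> A|.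
  rewrite -(index_quotient_eq _ sJP nNP) ?subIset ?joing_subl ?orbT //.
  rewrite quotientYidl //; apply: subset_leq_card; exact: imsetS.
rewrite -(leq_exp2l _ _ (prime_gt1 p_pr)) mulnC expnM -oE.
rewrite -(LagrangeI E (A / N)) expnMn.
rewrite mulSn addnC expnD leq_mul //.
  by rewrite mulnC expnM leq_exp2r.
by apply: leq_trans oPJ; rewrite leq_exp2r.
Qed.

End LinearPGroups.

(** * Representation dimension of abelian quotients *)

Lemma rdim_le (F : fieldType) (gT : finGroupType) (G : {group gT}) n :
  embeds_in_GL F G n -> (rdim F G <= n)%N.
Proof. by rewrite /rdim; case: ex_minnP => m _ min_m /asboolP/min_m. Qed.

Lemma rdim_embeds (F : fieldType) (gT : finGroupType) (G : {group gT}) :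
  embeds_in_GL F G (rdim F G).
Proof. by rewrite /rdim; case: ex_minnP => m /asboolP. Qed.

Theorem theoremF (R : realType) (gT : finGroupType) (G N : {group gT}) (n : nat)
    (nNG : (N <| G)%g) (abGN : abelian (G / N)%g) (rdimG : rdim R[i] G = n) :
  (rdim R[i] (G / N)%G)%:R <= (3 * n%:R) / 2 :> rat.
Proof.
have [rG ffulG] := rdim_embeds R[i] G; rewrite rdimG in rG ffulG.
have [chi sep_chi] := rank_separating_chars R[i] abGN.
have le_rdim := rdim_le (embeds_separating_chars sep_chi).
suffices: (2 * 'r(G / N)%g <= 3 * n)%N.
  move=> le_r; rewrite ler_pdivlMr ?ltr0n // mulrC -!natrM ler_nat.
  by apply: leq_trans le_r; rewrite leq_mul2l.
have [p p_pr ->] := rank_witness (G / N)%G.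
have [P sylP] := Sylow_exists p G; have [sPG pP _] := and3P sylP.
have nNP := subset_trans sPG (normal_norm nNG).
have sylPN := quotient_pHall nNP sylP.
(* [N] need not lie in [P], so the Sylow subgroup [P / N] of [G / N] is replaced by the isomorphic
   [P / (N :&: P)]. *)
rewrite -(p_rank_Sylow sylPN) -(isog_p_rank (second_isog nNP)).
apply: (@pgroup_quotient_p_rank _ _ p n P (N :&: P)%G (subg_repr rG sPG)) => //.
- exact: subg_mx_faithful.
- by rewrite /normal subsetIr normsI ?normG.
by rewrite (isog_abelian (second_isog nNP)) (abelianS (quotientS _ sPG)).
Qed.
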